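(* Let $b\in C^1(I_{2\varepsilon};\mathbb R)$ be such that there exists $\mathfrak m_b>0$ with $b'(x)\leqslant-\mathfrak m_b$ for every $x\in I_{2\varepsilon}$. Then there exists a constant $C>0$, depending only on $b$, $\mathfrak m_b$, $K$, $\mathtt l_0$, $\mathtt r_0$ and $\varepsilon$ (in particular not on $\ell$, $h$ nor on the estimator $\widehat b$), such that for every integrable estimator $\widehat b$ of $b$ on $I_{2\varepsilon}$ and all $\ell,h\in(0,\min\{1,\mathfrak m_b\}\varepsilon)$, $$\int_{I_0}\mathbb E(|\widehat b_{\ell,h}(x)-b(x)|)\,dx\leqslant C\,\bigl(\ell+h+\mathcal R(\widehat b)\bigr).$$
   Context: Let $\mathtt l_0<\mathtt r_0$ be real numbers and $\varepsilon\in(0,1]$. Put $I_0=[\mathtt l_0,\mathtt r_0]$ and, for $\lambda>0$, $\mathtt l_\lambda=\mathtt l_0-\lambda$, $\mathtt r_\lambda=\mathtt r_0+\lambda$, $I_\lambda=[\mathtt l_\lambda,\mathtt r_\lambda]$. Let $K\in C^2(\mathbb R;\mathbb R_+)$ be a kernel ($\int_{\mathbb R}K=1$) which is symmetric and supported in $[-1,1]$, and for $\eta\in(0,1]$ let $K_\eta(u)=\frac1\eta K(\frac u\eta)$. An integrable estimator $\widehat b$ of $b$ on $I_{2\varepsilon}$ is a (jointly measurable) random function $\widehat b:\Omega\times I_{2\varepsilon}\to\mathbb R$ on a probability space $(\Omega,\mathcal A,\mathbb P)$, integrable on $I_{2\varepsilon}$. Its integrated $\mathbb L^1$-risk is $\mathcal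 R(\widehat b)=\int_{I_{2\varepsilon}}\mathbb E(|\widehat b(x)-b(x)|)\,dx$. For $b$ strictly decreasing, $b(I_\varepsilon)=[b(\mathtt r_\varepsilon),b(\mathtt l_\varepsilon)]$. Define, for $w\in\mathbb R$ and $x\in I_0$, $$\widehat{\mathfrak b}_h^{-1}(w)=\mathtt l_{2\varepsilon}+\int_{I_{2\varepsilon}}\int_{-\infty}^{-w}K_h(-\widehat b(z)-y)\,dy\,dz,\qquad \widehat b_{\ell,h}(x)=b(\mathtt r_\varepsilon)+\int_{b(I_\varepsilon)}\int_{-\infty}^{-x}K_\ell(-\widehat{\mathfrak b}_h^{-1}(z)-y)\,dy\,dz.$$ (Here $\widehat{\mathfrak b}_h^{-1}$ is just a notation for the function so defined.) *)

(* Defs.v *)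
From HB Require Import structures.
From mathcomp Require Import all_boot all_order all_algebra.
From mathcomp Require Import all_classical all_reals all_analysis.
Set Implicit Arguments.
Unset Strict Implicit.
Unset Printing Implicit Defensive.
Import Order.TTheory GRing.Theory Num.Theory.
Import numFieldNormedType.Exports.
Local Open Scope classical_set_scope.
Local Open Scope ring_scope.

(** Derivative of [f] relative to the set [I]: one-sided at an endpoint of [I],
    so that values of [f] outside [I] play no role. *)
Definition diffq (R : realType) (f : R -> R) (x y : R) : R :=
  (f y - f x) / (y - x).

Definition derivable_on (R : realType) (I : set R) (f : R -> R) (x : R) : Prop :=
  cvg (diffq f x @ within I x^').

Definition derive_on (R : realType) (I : set R) (f : R -> R) (x : R) : R :=
  lim (diffq f x @ within I x^').

Definition C1_on (R : realType) (I : set R) (f : R -> R) : Prop :=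
  (forall x, I x -> derivable_on I f x) /\ {within I, continuous (derive_on I f)}.

Definition C2 (R : realType) (K : R -> R) : Prop :=
  [/\ forall x, derivable K x 1,
      forall x, derivable (derive1 K) x 1 &
      continuous (derive1n 2 K)].

Definition sym_kernel (R : realType) (K : R -> R) : Prop :=
  [/\ C2 K,
      forall u, 0 <= K u,
      (\int[@lebesgue_measure R]_u (K u)%:E = 1)%E,
      forall u, K (- u) = K u &
      forall u, 1 < `|u| -> K u = 0].

Definition rescale (R : realType) (K : R -> R) (eta u : R) : R :=
  eta^-1 * K (u / eta).

(** [enlarge l0 r0 lam] is the interval I_lam = [l0 - lam, r0 + lam]. *)
Definition enlarge (R : realType) (l0 r0 lam : R) : set R :=
  `[l0 - lam, r0 + lam].

(** The estimator [bh w x] is a total function of [x]; only its values for [x]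
    in [I] are constrained (and used below).  Its paths are required to be
    Lebesgue-integrable on [I] almost surely; no finiteness of the
    expectation of their integral is imposed. *)
Definition integrable_estimator (R : realType) (d : measure_display)
    (Omega : measurableType d) (P : probability Omega R) (I : set R)
    (bh : Omega -> R -> R) : Prop :=
  measurable_fun (setT `*` I)
    (fun p : Omega * measurableTypeR R => bh p.1 p.2) /\
  {ae P, forall w, (@lebesgue_measure R).-integrable I (EFin \o bh w)}.

(** Integrated L^1-distance on [I] between the random function [bh] and [b],
    with value in [0, +oo]. *)
Definition L1_risk (R : realType) (d : measure_display)
    (Omega : measurableType d) (P : probability Omega R) (I : set R)
    (b : R -> R) (bh : Omega -> R -> R) : \bar R :=
  (\int[@lebesgue_measure R]_(x in I) 'E_P[fun w => `|bh w x - b x|%R])%E.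

(** In the next two definitions [g] is a path of the estimator. *)
Definition binv_hat (R : realType) (K : R -> R) (l0 r0 eps h : R)
    (g : R -> R) (w : R) : R :=
  (l0 - 2 * eps) +
  \int[@lebesgue_measure R]_(z in enlarge l0 r0 (2 * eps))
    \int[@lebesgue_measure R]_(y in `]-oo, (- w)]) rescale K h (- g z - y).

Definition bhat_mono (R : realType) (K : R -> R) (l0 r0 eps : R) (b : R -> R)
    (l h : R) (g : R -> R) (x : R) : R :=
  b (r0 + eps) +
  \int[@lebesgue_measure R]_(z in b @` enlarge l0 r0 eps)
    \int[@lebesgue_measure R]_(y in `]-oo, (- x)])
      rescale K l (- binv_hat K l0 r0 eps h g z - y).

(* Main.v *)
Require Import Defs.
From HB Require Import structures.
From mathcomp Require Import all_boot all_order all_algebra.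
From mathcomp Require Import all_classical all_reals all_analysis.
From mathcomp Require Import measurable_realfun lra.
Set Implicit Arguments.
Unset Strict Implicit.
Unset Printing Implicit Defensive.
Import Order.TTheory GRing.Theory Num.Theory.
Import numFieldNormedType.Exports.
Local Open Scope classical_set_scope.
Local Open Scope ring_scope.

(** Both layers of the estimator integrate a smoothed step [Psi_h(a, w)] with
    values in [0, 1], equal to 1 for [w < a - h] and to 0 for [w > a + h].
    Hence [Psi_h(p, x)] differs from [1_{x < q}] only when [x] is [h]-close to
    the interval between [p] and [q], so that
    [int |Psi_h(p, x) - 1_{x < q}| dx <= 2 h + |p - q|].
    With sharp steps and [b] in place of its estimator the two layers are
    exact: [q = l_2eps + int_{I_2eps} 1_{b q < b t} dt] and
    [b x = b(r_eps) + int_{b(I_eps)} 1_{z < b x} dz].  Writing [z = b q] and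
    exchanging the order of integration once per layer, two applications of the
    displayed bound give, for each path [g] of the estimator,
    [int_{I_0} |bhat - b|
       <= 2 l |b(I_eps)| + 2 h |I_2eps| + int_{I_2eps} |g - b|],
    and it remains to take expectations. *)

(** * Integrals over rectangles *)

Section Tonelli.
Context {R : realType}.
Context d1 d2 (T1 : measurableType d1) (T2 : measurableType d2).
Context (m1 : {sigma_finite_measure set T1 -> \bar R}).
Context (m2 : {sigma_finite_measure set T2 -> \bar R}).
Variable f : T1 * T2 -> \bar R.
Hypothesis mf : measurable_fun setT f.
Hypothesis f0 : forall p, (0 <= f p)%E.

(** Extending [f] by zero outside the strip over [D] turns the integral over [D] into a partial
    integral over the whole space, where Tonelli's measurability statement applies. *)
Lemma measurable_fun_integral_snd (D : set T2) : measurable D ->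
  measurable_fun setT (fun x => \int[m2]_(y in D) f (x, y))%E.
Proof.
move=> mD.
have -> : (fun x => \int[m2]_(y in D) f (x, y))%E =
    fubini_F m2 (f \_ (setT `*` D)).
  apply/funext => x; rewrite /fubini_F (integral_mkcond D).
  by apply: eq_integral => y _; rewrite !patchE in_setX in_setT.
apply: measurable_fun_fubini_tonelli_F.
  apply/(measurable_restrictT _ _).1; first exact: measurableX.
  exact: measurable_funS mf.
by move=> p; rewrite patchE; case: ifP.
Qed.

Lemma measurable_fun_integral_fst (D : set T1) : measurable D ->
  measurable_fun setT (fun y => \int[m1]_(x in D) f (x, y))%E.
Proof.
move=> mD.
have -> : (fun y => \int[m1]_(x in D) f (x, y))%E =
    fubini_G m1 (f \_ (D `*` setT)).
  apply/funext => y; rewrite /fubini_G (integral_mkcond D).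
  by apply: eq_integral => x _; rewrite !patchE in_setX in_setT andbT.
apply: measurable_fun_fubini_tonelli_G.
  apply/(measurable_restrictT _ _).1; first exact: measurableX.
  exact: measurable_funS mf.
by move=> p; rewrite patchE; case: ifP.
Qed.

(** Here [f] is extended by zero outside the rectangle, which reduces the exchange to the one over
    the whole product. *)
Lemma tonelli_in (D1 : set T1) (D2 : set T2) : measurable D1 -> measurable D2 ->
  (\int[m1]_(x in D1) \int[m2]_(y in D2) f (x, y) =
   \int[m2]_(y in D2) \int[m1]_(x in D1) f (x, y))%E.
Proof.
move=> mD1 mD2; rewrite integral_mkcond [RHS]integral_mkcond.
pose k := f \_ (D1 `*` D2).
have -> : ((fun x => \int[m2]_(y in D2) f (x, y)) \_ D1 =
           (fun x => \int[m2]_y k (x, y)))%E.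
  apply/funext => x; rewrite patchE; case: ifPn => xD1.
    rewrite integral_mkcond; apply: eq_integral => y _.
    by rewrite /k !patchE in_setX xD1.
  rewrite (eq_integral (cst 0%E)) ?integral0// => y _.
  by rewrite /k patchE in_setX (negbTE xD1).
have -> : ((fun y => \int[m1]_(x in D1) f (x, y)) \_ D2 =
           (fun y => \int[m1]_x k (x, y)))%E.
  apply/funext => y; rewrite patchE; case: ifPn => yD2.
    rewrite integral_mkcond; apply: eq_integral => x _.
    by rewrite /k !patchE in_setX yD2 andbT.
  rewrite (eq_integral (cst 0%E)) ?integral0// => x _.
  by rewrite /k patchE in_setX (negbTE yD2) andbF.
apply: fubini_tonelli.
  apply/(measurable_restrictT _ _).1; first exact: measurableX.
  exact: measurable_funS mf.
by move=> p; rewrite /k patchE; case: ifP.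
Qed.

End Tonelli.

Lemma measurable_fun_Rintegral {R : realType} d1 d2
    (T1 : measurableType d1) (T2 : measurableType d2)
    (m2 : {sigma_finite_measure set T2 -> \bar R}) (f : T1 * T2 -> R)
    (D : set T2) :
  measurable_fun setT f -> (forall p, 0 <= f p) -> measurable D ->
  measurable_fun setT (fun x => \int[m2]_(y in D) f (x, y)).
Proof.
move=> mf f0 mD; apply: measurableT_comp => //.
apply: (@measurable_fun_integral_snd _ _ _ _ _ m2 (EFin \o f)) => //.
exact/measurable_EFinP.
Qed.

(** Functions with values in [0, 1] are integrable on a set of finite measure, so the difference of
    the integrals is the integral of the difference. The right side stays in the extended reals,
    ready for Tonelli. *)
Lemma Rintegral_dist {R : realType} d (T : measurableType d)
    (m : {measure set T -> \bar R}) (D : set T) (u v : T -> R) :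
  measurable D -> (m D < +oo)%E ->
  measurable_fun setT u -> measurable_fun setT v ->
  (forall x, 0 <= u x <= 1) -> (forall x, 0 <= v x <= 1) ->
  ((`|\int[m]_(x in D) u x - \int[m]_(x in D) v x|)%:E <=
   \int[m]_(x in D) (`|u x - v x|)%:E)%E.
Proof.
move=> mD mDoo mu mv u01 v01.
have I (w : T -> R) : measurable_fun setT w -> (forall x, 0 <= w x <= 1) ->
    m.-integrable D (EFin \o w).
  move=> mw w01; apply: measurable_bounded_integrable => //.
    exact: measurable_funS mw.
  exists 1; split=> // M M1 x Dx /=; have /andP[w0 w1] := w01 x.
  by rewrite ger0_norm// (le_trans w1)// ltW.
rewrite -RintegralB ?I//.
have iuv : m.-integrable D (EFin \o (u \- v)).
  by apply: (@integrableB _ _ _ m D mD (EFin \o u) (EFin \o v)); exact: I.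
apply: le_trans (_ : (\int[m]_(x in D) `|u x - v x|)%:E <= _)%E.
  by rewrite lee_fin; exact: (le_normr_Rintegral (f := u \- v)).
rewrite /Rintegral fineK//; apply: integrable_fin_num => //.
exact: (integrable_abse iuv).
Qed.

(** * Smoothed steps *)

Lemma measurable_natr_ltr {R : realType} d (T : measurableType d)
    (u v : T -> R) :
  measurable_fun setT u -> measurable_fun setT v ->
  measurable_fun setT (fun x => (u x < v x)%R%:R : R).
Proof.
move=> mu mv.
have -> : (fun x => (u x < v x)%R%:R : R) =
    (fun x => if u x < v x then 1 else 0).
  by apply/funext => x; case: ifP.
by apply: measurable_fun_ifT => //; exact: measurable_fun_ltr.
Qed.

Section Kernel.
Context {R : realType} (K : R -> R) (hK : sym_kernel K).
Notation mu := (@lebesgue_measure R).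

(* As [h] tends to 0 this tends to [1_{w < a}], except at [w = a]. *)
Definition smooth_step (h a w : R) : R :=
  \int[mu]_(y in `]-oo, (- w)%R]) rescale K h (- a - y).

Let K0 u : 0 <= K u. Proof. by case: hK. Qed.

Let cK : continuous K.
Proof.
case: hK => -[dK _ _] _ _ _ _ x.
by apply/differentiable_continuous/derivable1_diffP.
Qed.

Variables (h : R) (h0 : 0 < h).

Lemma rescale_ge0 u : 0 <= rescale K h u.
Proof. by rewrite /rescale mulr_ge0// invr_ge0 ltW. Qed.

Lemma rescale_eq0 u : h < `|u| -> rescale K h u = 0.
Proof.
case: hK => _ _ _ _ sK hu; rewrite /rescale sK ?mulr0//.
by rewrite normrM normfV (gtr0_norm h0) ltr_pdivlMr// mul1r.
Qed.

Lemma measurable_rescale : measurable_fun setT (rescale K h).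
Proof.
apply: measurable_funM => //; apply: measurableT_comp.
  exact: continuous_measurable_fun.
exact: measurable_funM.
Qed.

(** Substitution u = (y + a) / h in the unit mass of [K]; the change of sign is absorbed by
    symmetry. *)
Lemma integral_rescale a : (\int[mu]_y (rescale K h (- a - y))%:E = 1)%E.
Proof.
have [_ _ K1 KN _] := hK.
pose F y : R := (y + a) / h.
have dF (x : R) : is_derive x 1 F h^-1.
  rewrite /F; apply: is_derive_eq.
  by rewrite scaler0 add0r addr0 scaler1.
have F' : derive1 F = cst h^-1.
  by apply/funext => y; rewrite derive1E derive_val.
rewrite -K1 (@increasing_ge0_integration_by_substitutionT _ F K)//.
- apply: eq_integral => y _; congr EFin.
  rewrite !fctE /= F' /rescale /F /= mulrC; congr (_ * _).
  by rewrite -KN; congr K; rewrite -mulNr opprD !opprK addrC.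
- by move=> x y xy; rewrite ltr_pM2r ?invr_gt0// ltrD2r.
- by rewrite F' => x; exact: cvg_cst.
- by rewrite F'; exact: is_cvg_cst.
- by rewrite F'; exact: is_cvg_cst.
- apply/cvgrNyPle => A; near=> y; rewrite /F ler_pdivrMr// -lerBrDr.
  by near: y; apply: nbhs_ninfty_le; rewrite num_real.
- apply/cvgryPge => A; near=> y; rewrite /F ler_pdivlMr// -lerBlDr.
  by near: y; apply: nbhs_pinfty_ge; rewrite num_real.
Unshelve. all: by end_near. Qed.

Let mres (a : R) :
  measurable_fun setT (fun y : R => (rescale K h (- a - y))%:E).
Proof.
apply/measurable_EFinP/measurableT_comp; first exact: measurable_rescale.
exact: measurable_funB.
Qed.

(** The total mass 1 dominates the integral over the half-line, which is therefore finite: passing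
    to a real value loses nothing. *)
Let step_E a w : (smooth_step h a w)%:E =
  (\int[mu]_(y in `]-oo, (- w)%R]) (rescale K h (- a - y)%R)%:E)%E /\
  smooth_step h a w <= 1.
Proof.
have le1 :
  (\int[mu]_(y in `]-oo, (- w)%R]) (rescale K h (- a - y)%R)%:E <= 1)%E.
  rewrite -(integral_rescale a); apply: ge0_subset_integral => //.
    exact: mres.
  by move=> y _; rewrite lee_fin rescale_ge0.
have ge0 :
  (0 <= \int[mu]_(y in `]-oo, (- w)%R]) (rescale K h (- a - y)%R)%:E)%E.
  by apply: integral_ge0 => y _; rewrite lee_fin rescale_ge0.
have E : (smooth_step h a w)%:E =
  (\int[mu]_(y in `]-oo, (- w)%R]) (rescale K h (- a - y)%R)%:E)%E.
  rewrite /smooth_step /Rintegral fineK// ge0_fin_numE//.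
  by rewrite (le_lt_trans le1)// ltry.
by split=> //; rewrite -lee_fin E.
Qed.

Lemma smooth_step01 a w : 0 <= smooth_step h a w <= 1.
Proof.
rewrite (step_E a w).2 andbT.
by apply: Rintegral_ge0 => y _; exact: rescale_ge0.
Qed.

(** For y <= - w the argument - a - y exceeds [h]: the half-line misses the support. *)
Lemma smooth_step_eq0 a w : a + h < w -> smooth_step h a w = 0.
Proof.
move=> ahw; apply: EFin_inj; rewrite (step_E a w).1 integral0_eq// => y /=.
rewrite in_itv/= => yw; rewrite rescale_eq0// ltr_normr; apply/orP; left.
lra.
Qed.

(** For y > - w the argument - a - y is below - h: the half-line carries the whole mass. *)
Lemma smooth_step_eq1 a w : w < a - h -> smooth_step h a w = 1.
Proof.
move=> wah; apply: EFin_inj; rewrite (step_E a w).1 -(integral_rescale a).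
rewrite integral_mkcond; apply: eq_integral => y _.
rewrite patchE; case: ifPn => //; rewrite notin_setE/= in_itv/= => /negP.
rewrite -ltNge => yw; rewrite rescale_eq0// ltr_normr; apply/orP; right.
lra.
Qed.

(** The half-line depends on the second coordinate of the pair. Moving this cutoff into the
    integrand fixes the domain, so that measurability of partial integrals applies. *)
Let measurable_smooth_step_pair :
  measurable_fun setT (fun p : R * R => smooth_step h p.1 p.2).
Proof.
pose f (q : (R * R) * R) : R :=
  if q.2 <= - q.1.2 then rescale K h (- q.1.1 - q.2) else 0.
have -> : (fun p : R * R => smooth_step h p.1 p.2) =
          (fun p => \int[mu]_(y in setT) f (p, y)).
  apply/funext => p; rewrite /smooth_step Rintegral_mkcond.
  by apply: eq_Rintegral => y _; rewrite patchE /f/= mem_setE in_itv/=.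
apply: (@measurable_fun_Rintegral R _ _ _ (measurableTypeR R) mu f setT) => //.
  apply: measurable_fun_ifT => //.
    by apply: measurable_fun_ler => //; do 2?apply: measurableT_comp => //.
  apply: measurableT_comp; first exact: measurable_rescale.
  apply: measurable_funB => //; apply: measurableT_comp => //.
  exact: measurableT_comp.
by move=> q; rewrite /f; case: ifP => // _; exact: rescale_ge0.
Qed.

Lemma measurable_smooth_step d (T : measurableType d) (u v : T -> R) :
  measurable_fun setT u -> measurable_fun setT v ->
  measurable_fun setT (fun x => smooth_step h (u x) (v x)).
Proof.
move=> um vm.
exact: (measurableT_comp measurable_smooth_step_pair
  (measurable_fun_pair um vm)).
Qed.

(* The integrand is at most 1, and vanishes unless [x] is [h]-close to the
   interval with endpoints [p] and [q]. *)
Lemma smooth_step_L1 (D : set R) (p q : R) : measurable D ->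
  (\int[mu]_(x in D) (`|smooth_step h p x - (x < q)%R%:R|)%:E <=
   (2 * h + `|p - q|)%:E)%E.
Proof.
move=> mD; pose J := `[Num.min p q - h, Num.max p q + h]%classic.
have -> : (2 * h + `|p - q|)%:E = mu J.
  rewrite lebesgue_measure_itv/= lte_fin; have := h0; have [pq|qp] := leP p q.
    by move=> ?; rewrite ler0_norm ?subr_le0// ifT -?EFinD; [congr EFin|]; lra.
  by move=> ?; rewrite gtr0_norm ?subr_gt0// ifT -?EFinD; [congr EFin|]; lra.
have mJ : measurable J by exact: measurable_itv.
apply: (@le_trans _ _ (\int[mu]_(x in D) (\1_J x)%:E)%E); last first.
  by rewrite integral_indic// le_measure// inE//; exact: measurableI.
apply: ge0_le_integral => //.
- apply/measurable_EFinP/measurableT_comp => //.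
  apply: (measurable_funS measurableT) => //; apply: measurable_funB.
    exact: (measurable_smooth_step (u := cst p) (v := id)).
  exact: measurable_natr_ltr.
- exact/measurable_EFinP/(measurable_funS measurableT).
move=> x Dx; rewrite lee_fin indicE; have /andP[s0 s1] := smooth_step01 p x.
case: (boolP (x \in J)) => [_|].
  by rewrite ler_norml; case: (x < q) => /=; apply/andP; split; lra.
rewrite notin_setE /J/= in_itv/= => /negP; rewrite negb_and -!ltNge => xJ.
have [xmin|xmax] := orP xJ.
  have /andP[xp xq] : (x < p - h) && (x < q).
    by move: h0 xmin; have [pq|qp] := leP p q => ? ?; apply/andP; split; lra.
  by rewrite smooth_step_eq1// xq subrr normr0.
have /andP[xp xq] : (p + h < x) && (q <= x).
  by move: h0 xmax; have [pq|qp] := leP p q => ? ?; apply/andP; split; lra.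
by rewrite smooth_step_eq0// ltNge xq subrr normr0.
Qed.

End Kernel.

(** * Derivatives relative to a segment *)

Section C1.
Context {R : realType}.
Implicit Types (I : set R) (b : R -> R).

(** Near [x] the difference quotient is within 1 of its limit l, hence |b x - b y| <= (|l| + 1) |x -
    y| along [I]. *)
Lemma derivable_on_continuous I b :
  (forall x, I x -> derivable_on I b x) -> {within I, continuous b}.
Proof.
move=> db; apply/subspace_continuousP => x Ix.
have /cvgrPdist_lt /(_ 1 ltr01) := db x Ix.
set l := lim _ => dl.
have {dl}dl : \forall y \near x, y != x -> I y -> `|l - diffq b x y| < 1.
  exact: dl.
apply/cvgrPdist_lt => e e0.
have M0 : 0 < `|l| + 1 by rewrite ltr_wpDl.
rewrite near_withinE; near=> y => Iy; rewrite -/(`|b x - b y| < e).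
have [->|yx] := eqVneq y x; first by rewrite subrr normr0.
have dy : `|l - diffq b x y| < 1 by move: yx Iy; near: y.
have yxe : `|x - y| < e / (`|l| + 1).
  near: y; apply: cvgr_dist_lt; [exact: cvg_id|exact: divr_gt0].
have E : b y - b x = diffq b x y * (y - x).
  by rewrite /diffq divfK// subr_eq0.
have qM : `|diffq b x y| <= `|l| + 1.
  rewrite -(subKr l (diffq b x y)); apply: le_trans (ler_normB _ _) _.
  by rewrite lerD2l ltW// dy.
rewrite distrC E normrM (distrC y).
apply: (@le_lt_trans _ _ ((`|l| + 1) * `|x - y|)).
  by rewrite ler_wpM2r.
by rewrite mulrC -ltr_pdivlMr.
Unshelve. all: by end_near. Qed.

(** All points close to an interior [x] lie in the segment, so the relative limit is the ordinary
    one; the shift y = h + x gives the usual form of the quotient. *)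
Lemma is_derive_on_interior (L M : R) b x :
  derivable_on `[L, M] b x -> x \in `]L, M[ ->
  is_derive x 1 b (derive_on `[L, M] b x).
Proof.
rewrite /derivable_on /derive_on => db; rewrite in_itv/= => /andP[Lx xM].
suff H : h^-1 *: (b (h *: 1 + x) - b x) @[h --> 0^'] -->
         lim (diffq b x @ within `[L, M] x^').
  by split; [exact: cvgP H|exact: cvg_lim H].
have -> : (fun h : R => h^-1 *: (b (h *: 1 + x) - b x)) =
          diffq b x \o (fun h => h + x).
  by apply/funext => h; rewrite /diffq /= addrK scaler1 -[LHS]mulrC.
apply: cvg_comp db => P.
rewrite /within/= => xP.
have {}xP : \forall y \near x, y != x -> y \in `[L, M] -> P y by exact: xP.
have xLM : \forall y \near x, y \in `]L, M[.
  by apply: near_in_itvoo; rewrite in_itv/= Lx.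
have : \forall y \near x, y != x -> P y.
  near=> y => yx; have yLM : y \in `]L, M[ by near: y.
  have : y \in `[L, M] by exact: subset_itv_oo_cc.
  by move: yx; near: y.
move/nbhs0P; apply: filterS => h xh h0; rewrite /= addrC; apply: xh.
by rewrite -subr_eq0 addrAC subrr add0r.
Unshelve. all: by end_near. Qed.

(** Mean value theorem on [x, y]: points strictly between [x] and [y] are interior to [L, M], where
    the relative derivative is the ordinary one, even if [x] or [y] is an endpoint. *)
Lemma lt0_derive_on_decreasing (L M : R) b :
  (forall x, `[L, M]%classic x -> derivable_on `[L, M] b x) ->
  (forall x, `[L, M]%classic x -> derive_on `[L, M] b x < 0) ->
  {in `[L, M] &, {homo b : x y /~ x < y}}.
Proof.
move=> db b' y x; rewrite !in_itv/= => /andP[Ly yM] /andP[Lx xM] xy.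
have sub z : z \in `[x, y] -> `[L, M]%classic z.
  rewrite /= !in_itv/= => /andP[xz zy].
  by rewrite (le_trans Lx)// (le_trans zy).
have [z xyz E] : exists2 c, c \in `]x, y[%R &
    b y - b x = derive_on `[L, M] b c * (y - x).
  apply: MVT => //.
    move=> z; rewrite in_itv/= => /andP[xz zy].
    have zLM : z \in `]L, M[.
      by rewrite in_itv/= (le_lt_trans Lx)// (lt_le_trans zy).
    by apply: is_derive_on_interior => //; apply/db/subset_itv_oo_cc.
  by apply: continuous_subspaceW (derivable_on_continuous db) => z /sub.
rewrite -subr_lt0 E pmulr_llt0 ?subr_gt0// b'//.
by apply: sub; exact: subset_itv_oo_cc.
Qed.

End C1.

(** * The bound for a fixed path *)

Section Path.
Context {R : realType}.
Notation mu := (@lebesgue_measure R).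

Lemma set_itvccE (a c x : R) : `[a, c]%classic x = (a <= x <= c) :> Prop.
Proof. by rewrite /= in_itv. Qed.

(** The exactness of both layers with sharp steps rests on this length. *)
Lemma Rintegral_lt (a c m : R) : a <= m <= c ->
  \int[mu]_(z in `[a, c]) (z < m)%R%:R = m - a.
Proof.
move=> /andP[am mc]; rewrite /Rintegral.
rewrite (eq_integral (fun z : measurableTypeR R =>
    (\1_(`]-oo, m[%classic : set R) z)%:E)); last first.
  by move=> z _; rewrite indicE mem_setE in_itv/=.
rewrite integral_indic//.
have -> : `]-oo, m[%classic `&` `[a, c] = `[a, m[%classic.
  apply/seteqP; split => z /=; rewrite !in_itv/=.
    by move=> [-> /andP[-> _]].
  by move=> /andP[az zm]; rewrite zm az (le_trans (ltW zm)).
rewrite -[X in fine X]/(mu `[a, m[%classic) lebesgue_measure_itv/= lte_fin.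
(* If the strict test fails, then m = a and both sides are 0. *)
case: ltP => // ma.
by rewrite (le_anti (introT andP (conj am ma))) subrr.
Qed.

(** Monotonicity confines the image to the segment; the intermediate value theorem fills it. *)
Lemma decreasing_image_segment (b : R -> R) (x y : R) : x <= y ->
  {within `[x, y], continuous b} ->
  {in `[x, y] &, {homo b : u v /~ u < v}} ->
  b @` `[x, y] = `[b y, b x]%classic.
Proof.
move=> xy cb db.
have xI : x \in `[x, y] by rewrite in_itv/= lexx.
have yI : y \in `[x, y] by rewrite in_itv/= lexx andbT.
have le_b : {in `[x, y] &, {homo b : u v /~ u <= v}}.
  by move=> u v uI vI; rewrite le_eqVlt => /predU1P[->//|/db/ltW]; exact.
have byx : b y <= b x by exact: le_b.
apply/seteqP; split=> z /=.
  move=> [u uI <-]; rewrite in_itv/=.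
  have := uI; rewrite /= in_itv/= => /andP[xu uy].
  by rewrite !le_b.
rewrite in_itv/= => zb; have [|c cI <-] := @IVT _ b x y z xy cb.
  by rewrite (min_idPr byx) (max_idPl byx).
by exists c.
Qed.

(** * Joint measurability of the two layers *)

Context (K : R -> R) (hK : sym_kernel K) (l0 r0 eps : R).
Notation I0 := (`[l0, r0]%classic : set R).
Notation I1 := (enlarge l0 r0 eps).
Notation I2 := (enlarge l0 r0 (2 * eps)).

(** The parameter space [T] is arbitrary: the probability space serves for expectations, and a
    constant family over the line for a single path. *)
Lemma measurable_binv_hat d (T : measurableType d) (G : T -> R -> R) (h : R) :
  0 < h -> measurable_fun setT (fun p : T * measurableTypeR R => G p.1 p.2) ->
  measurable_fun setT
    (fun p : T * measurableTypeR R => binv_hat K l0 r0 eps h (G p.1) p.2).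
Proof.
move=> h0 mG; apply: measurable_funD => //.
apply: (@measurable_fun_Rintegral R _ _ _ (measurableTypeR R) mu
  (fun q : (T * measurableTypeR R) * measurableTypeR R =>
     smooth_step K h (G q.1.1 q.2) q.1.2) I2).
- apply: (measurable_smooth_step hK h0); last exact: measurableT_comp.
  have mq : measurable_fun setT
    (fun q : (T * measurableTypeR R) * measurableTypeR R =>
      (q.1.1, q.2)).
    by apply: measurable_fun_pair => //; exact: measurableT_comp.
  exact: (measurableT_comp mG mq).
- by move=> q; have /andP[] := smooth_step01 hK h0 (G q.1.1 q.2) q.1.2.
- exact: measurable_itv.
Qed.

Variables (b : R -> R) (l h : R).
Hypotheses (l_gt0 : 0 < l) (h_gt0 : 0 < h).
Notation J := (b @` I1).

Lemma measurable_bhat_mono d (T : measurableType d) (G : T -> R -> R) :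
  measurable J ->
  measurable_fun setT (fun p : T * measurableTypeR R => G p.1 p.2) ->
  measurable_fun setT
    (fun p : T * measurableTypeR R => bhat_mono K l0 r0 eps b l h (G p.1) p.2).
Proof.
move=> mJ mG; apply: measurable_funD => //.
apply: (@measurable_fun_Rintegral R _ _ _ (measurableTypeR R) mu
  (fun q : (T * measurableTypeR R) * measurableTypeR R =>
     smooth_step K l (binv_hat K l0 r0 eps h (G q.1.1) q.2) q.1.2) J) => //.
- apply: (measurable_smooth_step hK l_gt0); last exact: measurableT_comp.
  have mq : measurable_fun setT
    (fun q : (T * measurableTypeR R) * measurableTypeR R =>
      (q.1.1, q.2)).
    by apply: measurable_fun_pair => //; exact: measurableT_comp.
  exact: (measurableT_comp (measurable_binv_hat h_gt0 mG) mq).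
- move=> q.
  by have /andP[] :=
    smooth_step01 hK l_gt0 (binv_hat K l0 r0 eps h (G q.1.1) q.2) q.1.2.
Qed.

Hypotheses (lr : l0 < r0) (eps_gt0 : 0 < eps).
(** Measurability on the whole line and the shape of the image stand in for continuity, because
    these results are applied to an extension by zero. *)
Hypothesis mb : measurable_fun setT b.
Hypothesis db : {in `[l0 - 2 * eps, r0 + 2 * eps] &, {homo b : x y /~ x < y}}.
Hypothesis JE : J = `[b (r0 + eps), b (l0 - eps)]%classic.

Let sub01 x : I0 x -> I1 x.
Proof.
have ? := eps_gt0.
by rewrite /enlarge !set_itvccE => /andP[? ?]; apply/andP; split; lra.
Qed.

Let sub12 x : I1 x -> I2 x.
Proof.
have ? := eps_gt0.
by rewrite /enlarge !set_itvccE => /andP[? ?]; apply/andP; split; lra.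
Qed.

Let lI1 : I1 (l0 - eps).
Proof.
have ? := eps_gt0; have ? := lr.
by rewrite /enlarge set_itvccE; apply/andP; split; lra.
Qed.

Let rI1 : I1 (r0 + eps).
Proof.
have ? := eps_gt0; have ? := lr.
by rewrite /enlarge set_itvccE; apply/andP; split; lra.
Qed.

Let le_b x y : I2 x -> I2 y -> y <= x -> b x <= b y.
Proof. by move=> xI yI; rewrite le_eqVlt => /predU1P[->//|/db/ltW]; exact. Qed.

Let ltb x y : I2 x -> I2 y -> (b x < b y) = (y < x).
Proof.
move=> xI yI; have [yx|xy|->] := ltgtP y x; last by rewrite ltxx.
- exact: db.
- by apply/negbTE; rewrite -leNgt ltW// db.
Qed.

Let mJ : measurable J. Proof. by rewrite JE; exact: measurable_itv. Qed.
Let mI0 : measurable I0. Proof. exact: measurable_itv. Qed.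
Let mI2 : measurable I2. Proof. exact: measurable_itv. Qed.

Let ble : b (r0 + eps) <= b (l0 - eps).
Proof.
have ? := eps_gt0; have ? := lr.
by apply: le_b; [exact: sub12|exact: sub12|lra].
Qed.

Let muJ : mu J = (b (l0 - eps) - b (r0 + eps))%:E.
Proof.
rewrite JE lebesgue_measure_itv/= lte_fin ltNge; case: ltgtP ble => //=.
by move=> ->; rewrite subrr.
Qed.

Let muI2 : mu I2 = (r0 - l0 + 4 * eps)%:E.
Proof.
have ? := eps_gt0; have ? := lr.
rewrite lebesgue_measure_itv/= lte_fin ifT -?EFinD; last by lra.
by congr EFin; lra.
Qed.

Let muJoo : (mu J < +oo)%E. Proof. by rewrite muJ ltry. Qed.
Let muI2oo : (mu I2 < +oo)%E. Proof. by rewrite muI2 ltry. Qed.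

(** * Errors of the two layers along one path *)

Variable g : R -> R.
Hypothesis mg : measurable_fun setT g.

Let ginv := binv_hat K l0 r0 eps h g.

Let mginv : measurable_fun setT ginv.
Proof.
have mG : measurable_fun setT
    (fun p : measurableTypeR R * measurableTypeR R => g p.2).
  exact: measurableT_comp.
(* The path is viewed as a constant family, then the joint function is cut at the arbitrary
   parameter 0. *)
exact: (measurableT_comp (measurable_binv_hat (G := fun=> g) h_gt0 mG)
  (pair1_measurable (0 : R))).
Qed.

Let mbhat : measurable_fun setT (bhat_mono K l0 r0 eps b l h g).
Proof.
have mG : measurable_fun setT
    (fun p : measurableTypeR R * measurableTypeR R => g p.2).
  exact: measurableT_comp.
exact: (measurableT_comp (measurable_bhat_mono (G := fun=> g) mJ mG)
  (pair1_measurable (0 : R))).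
Qed.

(** Error of the outer step at a pair (x, z), with z a level in the image of [b]. *)
Let k (p : measurableTypeR R * measurableTypeR R) : R :=
  `|smooth_step K l (ginv p.2) p.1 - (p.2 < b p.1)%R%:R|.

(** Error of the inner step at a pair (z, t), the level now being the first coordinate. *)
Let k' (p : measurableTypeR R * measurableTypeR R) : R :=
  `|smooth_step K h (g p.2) p.1 - (p.1 < b p.2)%R%:R|.

Let mk : measurable_fun setT k.
Proof.
have ms := measurable_smooth_step hK l_gt0
  (measurableT_comp mginv (@measurable_snd _ _ (measurableTypeR R) _))
  measurable_fst.
have mi := measurable_natr_ltr
  (@measurable_snd _ _ (measurableTypeR R) _)
  (measurableT_comp mb measurable_fst).
exact: (measurableT_comp (@normr_measurable R setT) (measurable_funB ms mi)).
Qed.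

Let mk' : measurable_fun setT k'.
Proof.
have ms := measurable_smooth_step hK h_gt0
  (measurableT_comp mg (@measurable_snd _ _ (measurableTypeR R) _))
  measurable_fst.
have mi := measurable_natr_ltr
  (@measurable_fst _ _ _ (measurableTypeR R))
  (measurableT_comp mb measurable_snd).
exact: (measurableT_comp (@normr_measurable R setT) (measurable_funB ms mi)).
Qed.

(** Since b x lies in the segment J, b x - b(r_eps) is the integral over J of the sharp step 1_{z <
    b x}; only the steps remain to be compared. *)
Let bhat_dist x : I0 x ->
  ((`|bhat_mono K l0 r0 eps b l h g x - b x|)%:E <=
   \int[mu]_(z in J) (k (x, z))%:E)%E.
Proof.
move=> xI0.
have xI1 := sub01 xI0.
have := xI1; rewrite /enlarge set_itvccE => /andP[l0x xr0].
have bx : b x = b (r0 + eps) + \int[mu]_(z in J) (z < b x)%R%:R.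
  rewrite JE Rintegral_lt; first by rewrite addrC subrK.
  by rewrite !le_b//; exact: sub12.
rewrite {1}bx opprD addrACA subrr add0r.
apply: Rintegral_dist => //.
- exact: (measurable_smooth_step hK l_gt0 mginv (measurable_cst x)).
- exact: measurable_natr_ltr.
- by move=> z; exact: smooth_step01.
- by move=> z; case: (z < b x); rewrite /= lexx ler01.
Qed.

(** On I_2eps, b q < b t means t < q, which cuts out a length q - l_2eps: sharp steps invert [b]
    exactly. *)
Let ginv_dist q : I1 q ->
  ((`|ginv (b q) - q|)%:E <= \int[mu]_(t in I2) (k' (b q, t))%:E)%E.
Proof.
move=> qI1; have qI2 := sub12 qI1.
have E : q = (l0 - 2 * eps) + \int[mu]_(t in I2) (b q < b t)%R%:R.
  rewrite (@eq_Rintegral _ _ _ _ _ (fun t : measurableTypeR R => (t < q)%R%:R)).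
    by rewrite Rintegral_lt// addrC subrK.
  by move=> t; rewrite inE => tI2; rewrite ltb.
rewrite {2}E opprD addrACA subrr add0r.
apply: Rintegral_dist => //.
- exact: (measurable_smooth_step hK h_gt0 mg (measurable_cst (b q))).
- exact: measurable_natr_ltr.
- by move=> z; exact: smooth_step01.
- by move=> z; case: (b q < b z); rewrite /= lexx ler01.
Qed.

(** With z = b q, the condition z < b x becomes x < q, a sharp step in [x]. The smoothed one is
    centred at [ginv z], whose distance to [q] is already bounded. *)
Let k_int z : J z ->
  (\int[mu]_(x in I0) (k (x, z))%:E <=
   (2 * l)%:E + \int[mu]_(t in I2) (k' (z, t))%:E)%E.
Proof.
move=> [q qI1 <-].
rewrite (eq_integral
  (fun x : measurableTypeR R =>
     (`|smooth_step K l (ginv (b q)) x - (x < q)%R%:R|)%:E)).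
  apply: (le_trans (smooth_step_L1 hK l_gt0 _ q mI0)).
  by rewrite EFinD leeD2l// ginv_dist.
by move=> x; rewrite inE => /sub01/sub12 xI2; rewrite /k /= ltb//; exact: sub12.
Qed.

(** Each exchange makes the argument of a smoothed step the inner variable, so that its L1 bound
    applies: first in x, at cost 2 l, then in z, at cost 2 h. Integrating these constants gives the
    lengths of J and I_2eps as factors. *)
Lemma bhat_mono_L1 :
  (\int[mu]_(x in I0) (`|bhat_mono K l0 r0 eps b l h g x - b x|)%:E <=
   (2 * l * (b (l0 - eps) - b (r0 + eps)) + 2 * h * (r0 - l0 + 4 * eps))%:E +
   \int[mu]_(t in I2) (`|g t - b t|)%:E)%E.
Proof.
have mE (f : measurableTypeR R * measurableTypeR R -> R) :
  measurable_fun setT f -> measurable_fun setT (EFin \o f).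
  by move=> mf; exact/measurable_EFinP.
have k0 p : (0 <= (EFin \o k) p)%E by rewrite lee_fin normr_ge0.
have k'0 p : (0 <= (EFin \o k') p)%E by rewrite lee_fin normr_ge0.
apply: (@le_trans _ _ (\int[mu]_(x in I0) \int[mu]_(z in J) (k (x, z))%:E)%E).
  apply: ge0_le_integral => //.
  - apply/measurable_EFinP/measurableT_comp => //.
    by apply: (measurable_funS measurableT) => //; exact: measurable_funB.
  - apply: (measurable_funS measurableT) => //.
    exact: (measurable_fun_integral_snd mu (mE _ mk) k0 mJ).
rewrite (tonelli_in mu mu (mE _ mk) k0 mI0 mJ).
have mk'J : measurable_fun J (fun z => \int[mu]_(t in I2) (k' (z, t))%:E)%E.
  apply: (measurable_funS measurableT) => //.
  exact: (measurable_fun_integral_snd mu (mE _ mk') k'0 mI2).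
have int_k'0 z : (0 <= \int[mu]_(t in I2) (k' (z, t))%:E)%E.
  by apply: integral_ge0 => t _; exact: (k'0 (z, t)).
apply: (@le_trans _ _
  (\int[mu]_(z in J) ((2 * l)%:E + \int[mu]_(t in I2) (k' (z, t))%:E))%E).
  apply: ge0_le_integral; first exact: mJ.
  - by move=> z _; apply: integral_ge0 => x _; exact: (k0 (x, z)).
  - apply: (measurable_funS measurableT) => //.
    exact: (measurable_fun_integral_fst mu (mE _ mk) k0 mI0).
  - exact: (emeasurable_funD (measurable_cst _) mk'J).
  - exact: k_int.
have l2 : (0 <= (2 * l)%:E)%E by rewrite lee_fin mulr_ge0// ltW.
have h2 : (0 <= (2 * h)%:E)%E by rewrite lee_fin mulr_ge0// ltW.
rewrite ge0_integralD// integral_cst//.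
have -> : ((2 * l * (b (l0 - eps) - b (r0 + eps)) +
              2 * h * (r0 - l0 + 4 * eps))%:E =
   (2 * l)%:E * mu J + (2 * h)%:E * mu I2)%E by rewrite muJ muI2 -!EFinM -EFinD.
rewrite -addeA leeD2l//.
(* For fixed t, the inner error as a function of z compares a smoothed step centred at g t with the
   sharp one at b t, which produces |g t - b t|. *)
rewrite (tonelli_in mu mu (mE _ mk') k'0 mJ mI2).
have mgb : measurable_fun I2 (fun t => (`|g t - b t|)%:E).
  apply/measurable_EFinP/measurableT_comp => //.
  by apply: (measurable_funS measurableT) => //; exact: measurable_funB.
apply: (@le_trans _ _ (\int[mu]_(t in I2) ((2 * h)%:E + (`|g t - b t|)%:E))%E).
  apply: ge0_le_integral; first exact: mI2.
  - by move=> t _; apply: integral_ge0 => z _; exact: (k'0 (z, t)).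
  - apply: (measurable_funS measurableT) => //.
    exact: (measurable_fun_integral_fst mu (mE _ mk') k'0 mJ).
  - exact: (emeasurable_funD (measurable_cst _) mgb).
  - by move=> t _; exact: (smooth_step_L1 hK h_gt0 (g t) (b t) mJ).
by rewrite ge0_integralD// integral_cst.
Qed.

End Path.

(** * Expectation of the pathwise bound *)

Theorem theorem2p2 (R : realType) (l0 r0 eps : R) (K b : R -> R) (mb : R)
  (hlr : l0 < r0) (heps0 : 0 < eps) (heps1 : eps <= 1)
  (hK : sym_kernel K)
  (hb : C1_on (enlarge l0 r0 (2 * eps)) b)
  (hmb : 0 < mb)
  (hb' : forall x : R, enlarge l0 r0 (2 * eps) x ->
     derive_on (enlarge l0 r0 (2 * eps)) b x <= - mb) :
  exists C : R, 0 < C /\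
    forall (d : measure_display) (Omega : measurableType d)
      (P : probability Omega R) (bh : Omega -> R -> R),
      integrable_estimator P (enlarge l0 r0 (2 * eps)) bh ->
      forall l h : R,
        0 < l < Num.min 1 mb * eps -> 0 < h < Num.min 1 mb * eps ->
        (L1_risk P `[l0, r0] b (fun w x => bhat_mono K l0 r0 eps b l h (bh w) x)
         <= C%:E *
            (l%:E + h%:E + L1_risk P (enlarge l0 r0 (2 * eps)) b bh))%E.
Proof.
have cb := derivable_on_continuous hb.1.
have db : {in `[l0 - 2 * eps, r0 + 2 * eps] &, {homo b : x y /~ x < y}}.
  apply: lt0_derive_on_decreasing; first exact: hb.1.
  by move=> x xI; rewrite (le_lt_trans (hb' x xI))// oppr_lt0.
set I2 := enlarge l0 r0 (2 * eps) in hb hb' cb *.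
have mI2 : measurable I2 by exact: measurable_itv.
have sub (x : R) : l0 - eps <= x <= r0 + eps -> I2 x.
  by rewrite /I2 /enlarge set_itvccE => /andP[? ?]; apply/andP; split; lra.
have lI2 : I2 (l0 - eps) by apply: sub; apply/andP; split; lra.
have rI2 : I2 (r0 + eps) by apply: sub; apply/andP; split; lra.
(* The pathwise bound asks for measurability on the whole line; extension by zero provides it and
   keeps all values on I_2eps. *)
pose B : R -> R := b \_ I2.
have BE x : I2 x -> B x = b x by move=> xI; rewrite /B patchE mem_set.
have mB : measurable_fun setT B.
  apply/(measurable_restrictT _ _).1 => //.
  exact: subspace_continuous_measurable_fun.
have dB : {in `[l0 - 2 * eps, r0 + 2 * eps] &, {homo B : x y /~ x < y}}.
  by move=> x y xI yI xy; rewrite !BE//; exact: db.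
have BJ : B @` enlarge l0 r0 eps = b @` enlarge l0 r0 eps.
  apply: eq_imagel => x xI; apply: BE; apply: sub.
  by move: xI; rewrite /enlarge set_itvccE.
have JE : B @` enlarge l0 r0 eps = `[B (r0 + eps), B (l0 - eps)]%classic.
  rewrite BJ !BE//; apply: decreasing_image_segment; first by lra.
    by apply: continuous_subspaceW cb => x; rewrite set_itvccE => /sub.
  by move=> x y xI yI; apply: db; [apply: sub|apply: sub].
pose c := b (l0 - eps) - b (r0 + eps).
have c0 : 0 <= c by rewrite subr_ge0 ltW// db//; lra.
(* The terms after 1 are the coefficients of [l] and [h] in the pathwise bound; the 1 makes the
   factor of the risk at least 1. *)
exists (1 + 2 * c + 2 * (r0 - l0 + 4 * eps)); split; first by lra.
move=> d Omega P bh [mbh _] l h /andP[l_gt0 _] /andP[h_gt0 _].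
(* The paths are extended in the same way; joint measurability follows from that of [bh] on the
   strip over I_2eps. *)
pose G w : R -> R := bh w \_ I2.
have GE w x : I2 x -> G w x = bh w x by move=> xI; rewrite /G patchE mem_set.
have mG : measurable_fun setT (fun p : Omega * measurableTypeR R => G p.1 p.2).
  have -> : (fun p : Omega * measurableTypeR R => G p.1 p.2) =
      (fun p : Omega * measurableTypeR R => bh p.1 p.2) \_ (setT `*` I2).
    by apply/funext => -[w x]; rewrite /G !patchE in_setX in_setT.
  by apply/(measurable_restrictT _ _).1 => //; exact: measurableX.
have binvE w : binv_hat K l0 r0 eps h (bh w) = binv_hat K l0 r0 eps h (G w).
  apply/funext => z; congr (l0 - 2 * eps + _).
  by apply: eq_Rintegral => t; rewrite inE => /GE ->.
have bhatE w x : bhat_mono K l0 r0 eps b l h (bh w) x =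
                 bhat_mono K l0 r0 eps B l h (G w) x.
  by rewrite /bhat_mono binvE BJ (BE _ rI2).
pose mu := @lebesgue_measure R.
pose F (p : Omega * measurableTypeR R) : R :=
  `|bhat_mono K l0 r0 eps B l h (G p.1) p.2 - B p.2|.
pose H (p : Omega * measurableTypeR R) : R := `|G p.1 p.2 - B p.2|.
have mBs : measurable_fun setT (fun p : Omega * measurableTypeR R => B p.2).
  exact: (measurableT_comp mB measurable_snd).
have mJ : measurable (B @` enlarge l0 r0 eps).
  by rewrite JE; exact: measurable_itv.
have mF : measurable_fun setT (EFin \o F).
  apply/measurable_EFinP.
  exact: (measurableT_comp (@normr_measurable R setT)
    (measurable_funB (measurable_bhat_mono hK l_gt0 h_gt0 mJ mG) mBs)).
have mH : measurable_fun setT (EFin \o H).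
  apply/measurable_EFinP.
  exact: (measurableT_comp (@normr_measurable R setT) (measurable_funB mG mBs)).
have F0 p : (0 <= (EFin \o F) p)%E by rewrite lee_fin normr_ge0.
have H0 p : (0 <= (EFin \o H) p)%E by rewrite lee_fin normr_ge0.
(* Tonelli moves the expectation outside, so that the bound can be applied path by path. *)
have -> : L1_risk P `[l0, r0] b
      (fun w x => bhat_mono K l0 r0 eps b l h (bh w) x) =
    (\int[P]_w \int[mu]_(x in `[l0, r0]) (F (w, x))%:E)%E.
  rewrite (tonelli_in P mu mF F0 measurableT (measurable_itv _)).
  apply: eq_integral => x; rewrite inE set_itvccE => /andP[lx xr].
  rewrite unlock; apply: eq_integral => w _.
  rewrite /F /= -bhatE BE//; apply: sub; apply/andP; split; lra.
have -> : L1_risk P I2 b bh = (\int[P]_w \int[mu]_(x in I2) (H (w, x))%:E)%E.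
  rewrite (tonelli_in P mu mH H0 measurableT mI2).
  apply: eq_integral => x; rewrite inE => xI.
  by rewrite unlock; apply: eq_integral => w _; rewrite /H /= GE// BE.
set rF := (\int[P]_w _)%E; set rH := (\int[P]_w _)%E.
pose c' := 2 * l * c + 2 * h * (r0 - l0 + 4 * eps).
have Hw0 w : (0 <= \int[mu]_(x in I2) (H (w, x))%:E)%E.
  by apply: integral_ge0 => x _; exact: (H0 (w, x)).
have mHw := measurable_fun_integral_snd mu mH H0 mI2.
have c'0 : (0 <= c'%:E)%E by rewrite lee_fin /c'; nra.
have FH : (rF <= c'%:E + rH)%E.
  (* As [P] has mass 1, the constant is its own expectation and can enter the integral. Everything
     is in the extended reals, so an infinite risk needs no separate case. *)
  have -> : (c'%:E + rH =
      \int[P]_w (c'%:E + \int[mu]_(x in I2) (H (w, x))%:E))%E.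
    rewrite ge0_integralD// integral_cst//; congr (_ + _)%E.
    by rewrite -[LHS]mule1; congr (_ * _)%E; exact/esym/(probability_setT P).
  apply: ge0_le_integral; first exact: measurableT.
  - by move=> w _; apply: integral_ge0 => x _; exact: (F0 (w, x)).
  - exact: (measurable_fun_integral_snd mu mF F0 (measurable_itv _)).
  - exact: (emeasurable_funD (measurable_cst _) mHw).
  - move=> w _.
    have mGw : measurable_fun setT (G w).
      exact: (measurableT_comp mG (pair1_measurable w)).
    have := bhat_mono_L1 hK l_gt0 h_gt0 hlr heps0 mB dB JE mGw.
    by rewrite !BE.
apply: (le_trans FH).
have rH0 : (0 <= rH)%E by exact: integral_ge0.
rewrite -EFinD ge0_muleDr//; last by rewrite lee_fin; lra.
rewrite -EFinM; apply: leeD.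
  by rewrite lee_fin /c'; nra.
by apply: lee_pemull => //; rewrite lee_fin; lra.
Qed.
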